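(* Let $\Gamma(\mathbf z)=\sum_{\mathbf i\in\mathbb N^d} f_{\mathbf i}\mathbf z^{\mathbf i}$ be a power series with nonnegative coefficients whose domain of absolute convergence has nonempty interior $\mathscr D\subset\mathbb C^d$. Let $\nu=\nu_\Gamma$ be the measure on $\mathbb R^d$ given by $\nu(S)=\sum_{\mathbf i\in S\cap\mathbb N^d} f_{\mathbf i}$. Assume that $\Gamma$ satisfies the concave growth condition (CG): there exist $a,b,c>0$ such that for all $\mathbf x,\mathbf y\in\mathbb R^d$, $$\nu(B_{\mathbf x+\mathbf y}(a))\ \ge\ c\,\nu(B_{\mathbf x}(b))\,\nu(B_{\mathbf y}(b)),$$ and assume $\tau_\nu:=\sup_{\|\mathbf x\|=1}\psi_\Gamma(\mathbf x)<\infty$. Let $\Omega=\mathrm{Relog}(\mathscr D\cap\mathbb C_*^d)$ and let $\overline\Omega$ be its closure in $\mathbb R^d$. Then $-\psi_\Gamma$ is the support function of $\overline\Omega$, i.e. $-\psi_\Gamma(\mathbf x)=\sup_{\theta\in\overline\Omega}\langle\mathbf x,\theta\rangle$ for all $\mathbf x\in\mathbb R^d$, and for $\mathbf x\in\mathbb R^d_{\ge0}$ $$\psi_\Gamma(\mathbf x)=\inf_{\theta\in-\overline\Omega}\langle\mathbf x,\theta\rangle,$$ and, if $\Omega\ne\mathbb R^d$, $$\psi_\Gamma(\mathbf x)=\inf_{\theta\in-\partial\overline\Omega}\langle\mathbf x,\theta\rangle .$$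
   Context: $\|\cdot\|$ is the $\ell^1$ norm on $\mathbb R^d$ and $B_{\mathbf x}(a)$ is the closed/open ball of radius $a$ centered at $\mathbf x$ for this norm. $\mathbb C_*=\mathbb C\setminus\{0\}$ and $\mathrm{Relog}:\mathbb C_*^d\to\mathbb R^d$, $\mathrm{Relog}(\mathbf z)=(\log|z_1|,\dots,\log|z_d|)$. $\langle\cdot,\cdot\rangle$ is the standard inner product. The indicatrice of growth $\psi_\Gamma:\mathbb R^d\to\mathbb R\cup\{-\infty\}$ is defined by: for an open cone $C\subset\mathbb R^d$, $\tau_C=\limsup_{R\to\infty}\frac1R\log\Big(\sum_{\mathbf i\in C\cap\mathbb N^d,\ R\le\|\mathbf i\|\le R+1} f_{\mathbf i}\Big)$ (with $\log 0=-\infty$), and for $\mathbf x\ne0$, $\psi_\Gamma(\mathbf x)=\|\mathbf x\|\inf_{C\ni\mathbf x}\tau_C$, the infimum over open cones containing $\mathbf x$; $\psi_\Gamma(\mathbf 0)=0$. *)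

(* Defs.v *)
From HB Require Import structures.
From mathcomp Require Import all_boot all_order all_algebra.
From mathcomp Require Import all_classical all_reals all_analysis.
From mathcomp Require Import complex.
Set Implicit Arguments. Unset Strict Implicit. Unset Printing Implicit Defensive.
Import Order.TTheory GRing.Theory Num.Theory.
Import numFieldNormedType.Exports.
Local Open Scope classical_set_scope.
Local Open Scope ring_scope.

Section Defs.
Variables (R : realType) (d : nat).

Definition l1norm (x : 'rV[R]_d) : R := \sum_(j < d) `|x ord0 j|.

Definition inner (x y : 'rV[R]_d) : R := \sum_(j < d) x ord0 j * y ord0 j.

Definition l1ball (x : 'rV[R]_d) (a : R) : set 'rV[R]_d :=
  [set y | l1norm (y - x) <= a].

Definition natvec (i : 'rV[nat]_d) : 'rV[R]_d := map_mx (fun n : nat => n%:R) i.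

Definition nuG (f : 'rV[nat]_d -> R) (S : set 'rV[R]_d) : \bar R :=
  \esum_(i in [set i | S (natvec i)]) (f i)%:E.

Definition open_cone (C : set 'rV[R]_d) : Prop :=
  open C /\ (forall x t, C x -> 0 < t -> C (t *: x)).

(* tau_C = limsup_{r -> +oo} (1/r) log ( sum_{i in C cap N^d, r <= |i| <= r+1} f_i ),
   with log 0 = -oo (lne) *)
Definition tauC (f : 'rV[nat]_d -> R) (C : set 'rV[R]_d) : \bar R :=
  limf_esup (fun r : R =>
    ((r^-1)%:E *
     lne (\esum_(i in [set i | C (natvec i) /\
                              (r <= l1norm (natvec i) <= r + 1)%R]) (f i)%:E))%E)
    (pinfty_nbhs R).

Definition psiG (f : 'rV[nat]_d -> R) (x : 'rV[R]_d) : \bar R :=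
  if x == 0 then 0%E
  else ((l1norm x)%:E *
        ereal_inf [set tauC f C | C in [set C | open_cone C /\ C x]])%E.

Definition cmod (z : R[i]) : R := complex.Re `|z|.

Definition abs_series (f : 'rV[nat]_d -> R) (z : 'rV[R[i]]_d) : \bar R :=
  \esum_(i in [set: 'rV[nat]_d])
     (f i * \prod_(j < d) cmod (z ord0 j) ^+ (i ord0 j))%:E.

Definition abs_conv_dom (f : 'rV[nat]_d -> R) : set 'rV[R[i]]_d :=
  [set z | (abs_series f z < +oo)%E].

Definition cinterior (S : set 'rV[R[i]]_d) : set 'rV[R[i]]_d :=
  [set z | exists2 e : R, 0 < e &
     forall w : 'rV[R[i]]_d, (forall j, cmod (w ord0 j - z ord0 j) < e) -> S w].

Definition convD (f : 'rV[nat]_d -> R) : set 'rV[R[i]]_d :=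
  cinterior (abs_conv_dom f).

Definition Relog (z : 'rV[R[i]]_d) : 'rV[R]_d := \row_j ln (cmod (z ord0 j)).

Definition OmegaG (f : 'rV[nat]_d -> R) : set 'rV[R]_d :=
  Relog @` [set z | convD f z /\ forall j, z ord0 j != 0].

Definition boundary (A : set 'rV[R]_d) : set 'rV[R]_d :=
  closure A `\` interior A.

End Defs.

(* Main.v *)
Require Import Defs.
From HB Require Import structures.
From mathcomp Require Import all_boot all_order all_algebra.
From mathcomp Require Import all_classical all_reals all_analysis.
From mathcomp Require Import complex.
From mathcomp Require Import ring lra.
Import Order.TTheory GRing.Theory Num.Theory.
Import numFieldNormedType.Exports.
Local Open Scope classical_set_scope.
Local Open Scope ring_scope.
Set Implicit Arguments. Unset Strict Implicit. Unset Printing Implicit Defensive.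

(* A theta in Omega bounds f_i by a multiple of e^{-<i, theta>}; evaluating
   tau_C on the open cones -<y, theta> < b |y| gives psi(x) <= -<x, theta>.

   Conversely, (CG) makes L_i = ln f_i + const superadditive up to a bounded
   error in the index: for f_i, f_j > 0 some k with |k - i - j| <= a has
   L_k >= L_i + L_j. Let K be the rational convex cone in R^d x R spanned by the
   pairs (i, L_i) with |i| >= r, closed downwards in the last coordinate. The
   index error is at most a/r relative to |k|, so for r large a point (x, -s)
   with psi(x) < -s stays at positive distance from K. A hyperplane (theta, la)
   separating them has la >= 0. If la > 0 then f_i <= const e^{-<i, theta/la>},
   so theta/la, lowered slightly, lies in Omega; if la = 0 then theta is a
   direction along which Omega is unbounded. Either way Omega contains a point
   theta' with <x, theta'> >= s.

   Omega is stable under decreasing coordinates, so when it is not the whole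
   space every point of its closure can be raised along (1, ..., 1) to a boundary
   point, which only increases <x, .> for x >= 0. *)

(** * Sums over the lattice *)

Section esum_lemmas.
Variables (R : realType) (T : choiceType).
Implicit Types (S : set T) (a b : T -> \bar R).
Local Open Scope ereal_scope.

Lemma ge_esum S a (B : \bar R) :
  (forall s : seq T, uniq s -> {in s, forall t, S t} -> \sum_(i <- s) a i <= B) ->
  \esum_(i in S) a i <= B.
Proof.
move=> h; apply: ge_ereal_sup => _ [X [finX XS] <-].
rewrite fsbig_finite//=; apply: h; first exact: finmap.fset_uniq.
by move=> t; rewrite in_fset_set// inE => /XS.
Qed.

Lemma le_esum_subset S S' a : S `<=` S' ->
  \esum_(i in S) a i <= \esum_(i in S') a i.
Proof.
move=> SS; apply: le_ereal_sup => _ [X [finX XS] <-]; exists X => //.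
by split => //; apply: subset_trans SS.
Qed.

Lemma esum_ge1 S a k : S k -> a k <= \esum_(i in S) a i.
Proof.
move=> Sk; apply: esum_ge; exists [set k]; last by rewrite fsbig_set1.
by split => // x ->.
Qed.

Lemma esumZl_le S a (k : R) : (0 <= k)%R -> (forall i, S i -> 0 <= a i) ->
  \esum_(i in S) (k%:E * a i) <= k%:E * \esum_(i in S) a i.
Proof.
move=> k0 a0; apply: ge_ereal_sup => _ [X [finX XS] <-].
rewrite fsbig_finite//=.
rewrite big_seq -ge0_sume_distrr; last first.
  by move=> i; rewrite in_fset_set// inE => /XS/a0.
rewrite lee_wpmul2l//; last first.
apply: ereal_sup_ubound; exists X => //; rewrite fsbig_finite//=.
by rewrite [LHS]big_seq.
Qed.
End esum_lemmas.

Lemma geometric_sum_le (R : realType) (q : R) (n : nat) : 0 < q < 1 ->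
  \sum_(0 <= k < n) q ^+ k <= (1 - q)^-1.
Proof.
move=> /andP[q0 q1].
have := @geometric_le_lim R n 1 q ler01 q0; rewrite (ger0_norm (ltW q0)).
move=> /(_ q1); rewrite div1r /series /= /geometric/=.
by under eq_bigr do rewrite mul1r.
Qed.

(** Cutting at [m] leaves two geometric sums of ratio [expR (- e)], the lower one read backwards.
    The bound depends neither on [m] nor on [n]. *)
Lemma two_sided_geometric_sum_le (R : realType) (e : R) (m n : nat) : 0 < e ->
  \sum_(k < n) expR (- e * `|k%:R - m%:R|) <= 2 / (1 - expR (- e)).
Proof.
move=> e0; set q := expR (- e).
have q01 : 0 < q < 1 by rewrite expR_gt0 expR_lt1 oppr_lt0 e0.
have qX k : expR (- e * k%:R) = q ^+ k by rewrite mulrC expRM_natl.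
rewrite -(big_mkord xpredT (fun k => expR (- e * `|k%:R - m%:R|))).
(* The range is lengthened to [m + n] so that the cut at [m] is possible even when [n < m]. *)
apply: (@le_trans _ _
    (\sum_(0 <= k < m + n) expR (- e * `|k%:R - m%:R|))).
  rewrite addnC (big_cat_nat (leq0n n) (leq_addr m n))/= lerDl.
  by apply: sumr_ge0 => i _; exact: expR_ge0.
rewrite (big_cat_nat (leq0n m) (leq_addr n m))/= mulr_natl mulr2n.
apply: lerD.
  rewrite big_nat_rev/= add0n.
  apply: le_trans _ (geometric_sum_le m q01).
  rewrite big_nat [leRHS]big_nat; apply: ler_sum => i /andP[_ im].
  rewrite distrC -natrB ?leq_subr// subKn// ger0_norm// qX exprS.
  by case/andP: q01 => q0 /ltW q1; rewrite ler_piMl// exprn_ge0// ltW.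
rewrite -{1}(add0n m) big_addn addKn.
apply: le_trans _ (geometric_sum_le n q01); apply: ler_sum => i _.
by rewrite natrD addrK ger0_norm// qX.
Qed.

(** The exponential of an l1 norm is a product over coordinates, so the sum over a box factors into
    two-sided geometric sums. What matters later is that [M] is uniform in the centre [m]. *)
Lemma lattice_sum_bounded (R : realType) (d : nat) (e : R) : 0 < e ->
  exists2 M : R, 0 < M & forall m : 'rV[nat]_d,
    (\esum_(k in [set: 'rV[nat]_d])
       (expR (- e * l1norm (natvec R k - natvec R m)))%:E <= M%:E)%E.
Proof.
move=> e0; have q1 : expR (- e) < 1 by rewrite expR_lt1 oppr_lt0.
exists ((2 / (1 - expR (- e))) ^+ d).
  by rewrite exprn_gt0// divr_gt0// subr_gt0.
move=> m; apply: ge_esum => s us _.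
rewrite sumEFin lee_fin.
(* The finite family [s] is embedded in the box [{0..N}^d], over which the sum of products is a
   product of sums. *)
pose N := \max_(k <- s) \max_j k ord0 j.
pose h (k : 'rV[nat]_d) : {ffun 'I_d -> 'I_N.+1} := [ffun j => inord (k ord0 j)].
have hE (k : 'rV[nat]_d) j : k \in s -> h k j = k ord0 j :> nat.
  move=> ks; rewrite ffunE inordK// ltnS.
  apply: leq_trans (leq_bigmax j) _.
  exact: (@leq_bigmax_seq _ s xpredT (fun k : 'rV[nat]_d => \max_j k ord0 j)%N).
have hinj : {in s &, injective h}.
  by move=> k k' ks k's hk; apply/rowP => j; rewrite -!hE// hk.
pose G (p : {ffun 'I_d -> 'I_N.+1}) : R :=
  \prod_j expR (- e * `|(p j)%:R - (m ord0 j)%:R|).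
have G0 p : 0 <= G p by apply: prodr_ge0 => j _; exact: expR_ge0.
rewrite (eq_big_seq (G \o h)); last first.
  move=> k ks /=; rewrite /l1norm mulr_sumr expR_sum; apply: eq_bigr => j _.
  by rewrite !mxE -hE.
rewrite -(big_map h xpredT G) big_uniq/=; last by rewrite map_inj_in_uniq.
apply: (@le_trans _ _ (\sum_p G p)).
  rewrite [leRHS](bigID (mem [seq h i | i <- s]))/= lerDl.
  exact: sumr_ge0.
rewrite /G -(bigA_distr_bigA (fun (j : 'I_d) (i : 'I_N.+1) =>
  expR (- e * `|i%:R - (m ord0 j)%:R|))) -[d in X in _ <= X]card_ord -prodr_const.
apply: ler_prod => j _; rewrite two_sided_geometric_sum_le// andbT.
by apply: sumr_ge0 => i _; exact: expR_ge0.
Qed.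

(** * The logarithmic domain of convergence *)

Section l1_inner.
Variables (R : realType) (d : nat).
Implicit Types (x y th : 'rV[R]_d) (i : 'rV[nat]_d).

Lemma l1norm_ge0 x : 0 <= l1norm x.
Proof. exact: sumr_ge0. Qed.

Lemma l1normN x : l1norm (- x) = l1norm x.
Proof. by apply: eq_bigr => j _; rewrite mxE normrN. Qed.

Lemma l1normD x y : l1norm (x + y) <= l1norm x + l1norm y.
Proof.
by rewrite /l1norm -big_split/=; apply: ler_sum => j _; rewrite mxE ler_normD.
Qed.

Lemma ler_dist_l1norm x y : `|l1norm x - l1norm y| <= l1norm (x - y).
Proof.
rewrite ler_norml; apply/andP; split; last first.
  by rewrite lerBlDr -{1}(subrK y x) l1normD.
rewrite lerBrDr addrC lerBlDr -(l1normN (x - y)) opprB -{1}(subrK x y) addrC.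
exact: l1normD.
Qed.

Lemma l1normZ (t : R) x : l1norm (t *: x) = `|t| * l1norm x.
Proof. by rewrite /l1norm mulr_sumr; apply: eq_bigr => j _; rewrite mxE normrM. Qed.

Lemma le_l1norm x j : `|x ord0 j| <= l1norm x.
Proof. by rewrite /l1norm (bigD1 j)//= lerDl sumr_ge0. Qed.

Lemma l1norm_gt0 x : x != 0 -> 0 < l1norm x.
Proof.
move=> x0; rewrite lt_def l1norm_ge0 andbT; apply: contra x0 => /eqP n0.
apply/eqP/rowP => j; rewrite mxE; apply/eqP; rewrite -normr_le0 -n0.
exact: le_l1norm.
Qed.

Lemma innerDl x y th : inner (x + y) th = inner x th + inner y th.
Proof. by rewrite /inner -big_split/=; apply: eq_bigr => j _; rewrite mxE mulrDl. Qed.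

Lemma innerC x y : inner x y = inner y x.
Proof. by apply: eq_bigr => j _; rewrite mulrC. Qed.

Lemma innerZl (t : R) x th : inner (t *: x) th = t * inner x th.
Proof. by rewrite /inner mulr_sumr; apply: eq_bigr => j _; rewrite mxE mulrA. Qed.

Lemma innerDr x y th : inner th (x + y) = inner th x + inner th y.
Proof. by rewrite !(innerC th) innerDl. Qed.

Lemma innerZr (t : R) x th : inner th (t *: x) = t * inner th x.
Proof. by rewrite !(innerC th) innerZl. Qed.

Lemma innerNl x th : inner (- x) th = - inner x th.
Proof. by rewrite -scaleN1r innerZl mulN1r. Qed.

Lemma innerNr x th : inner th (- x) = - inner th x.
Proof. by rewrite !(innerC th) innerNl. Qed.

Lemma ler_norm_inner x y : `|inner x y| <= l1norm x * l1norm y.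
Proof.
apply: le_trans (ler_norm_sum _ _ _) _.
rewrite {1}/l1norm mulr_suml; apply: ler_sum => j _.
by rewrite normrM ler_wpM2l// le_l1norm.
Qed.

Lemma inner_const_mx x (e : R) : inner x (const_mx e) = (\sum_j x ord0 j) * e.
Proof. by rewrite /inner mulr_suml; apply: eq_bigr => j _; rewrite mxE. Qed.

Lemma l1norm_nneg x : (forall j, 0 <= x ord0 j) -> l1norm x = \sum_j x ord0 j.
Proof. by move=> x0; apply: eq_bigr => j _; rewrite ger0_norm. Qed.

Lemma natvec_ge0 i j : 0 <= natvec R i ord0 j.
Proof. by rewrite mxE. Qed.

Lemma le_inner (x th th' : 'rV[R]_d) : (forall j, 0 <= x ord0 j) ->
  (forall j, th ord0 j <= th' ord0 j) -> inner x th <= inner x th'.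
Proof. by move=> x0 le; apply: ler_sum => j _; rewrite ler_wpM2l. Qed.

End l1_inner.

Section cmod.
Local Open Scope complex_scope.
Variable R : realType.
Implicit Types z w : R[i].

Lemma cmodE z : `|z| = (cmod z)%:C.
Proof. by rewrite /cmod normc_def. Qed.

Lemma cmod_ge0 z : 0 <= cmod z.
Proof. by rewrite -ler0c -cmodE normr_ge0. Qed.

Lemma cmod_real (r : R) : 0 <= r -> cmod r%:C = r.
Proof.
by move=> r0; apply: complexI; rewrite -cmodE ger0_norm// ler0c.
Qed.

Lemma cmodM z w : cmod (z * w) = cmod z * cmod w.
Proof. by apply: complexI; rewrite -cmodE normrM !cmodE rmorphM. Qed.

Lemma cmodD z w : cmod (z + w) <= cmod z + cmod w.
Proof. by rewrite -lecR rmorphD/= -!cmodE ler_normD. Qed.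

Lemma cmod_gt0 z : z != 0 -> 0 < cmod z.
Proof. by move=> z0; rewrite -ltcR -cmodE normr_gt0. Qed.

End cmod.

Section log_domain.
Local Open Scope complex_scope.
Variables (R : realType) (d : nat) (f : 'rV[nat]_d -> R).
Hypothesis f0 : forall i, 0 <= f i.
Implicit Types (th : 'rV[R]_d) (z : 'rV[R[i]]_d).

(** This is the value of the series at the point with coordinates [expR (th_j)], that is, the series
    in logarithmic coordinates. *)
Definition laplace (th : 'rV[R]_d) : \bar R :=
  \esum_(i in [set: 'rV[nat]_d]) (f i * expR (inner (natvec R i) th))%:E.

Lemma le_laplace th th' : (forall j, th ord0 j <= th' ord0 j) ->
  (laplace th <= laplace th')%E.
Proof.
move=> le; apply: le_esum => i _; rewrite lee_fin ler_wpM2l// ler_expR.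
by apply: le_inner => // j; exact: natvec_ge0.
Qed.

Lemma abs_seriesE z : (forall j, z ord0 j != 0) ->
  abs_series f z = laplace (Relog z).
Proof.
move=> z0; apply: eq_esum => i _; congr (_ * _)%:E.
rewrite expR_sum; apply: eq_bigr => j _.
by rewrite !mxE expRM_natl lnK// posrE cmod_gt0.
Qed.

(** The coefficients being nonnegative, the series of moduli is monotone in each modulus.
    Convergence on a whole neighbourhood therefore amounts to convergence at one point larger in
    every coordinate. *)
Lemma OmegaGP th : OmegaG f th <->
  exists2 e : R, 0 < e & (laplace (th + const_mx e) < +oo)%E.
Proof.
split.
  move=> [z [[e e0 ze] z0] <-].
  pose S := \sum_j cmod (z ord0 j).
  have S0 : 0 <= S by apply: sumr_ge0 => j _; exact: cmod_ge0.
  (* Scaling [z] by [1 + eta] moves each coordinate by [eta * |z_j| <= eta * S < e]. *)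
  pose eta := e / (S + 1).
  have eta0 : 0 < eta by rewrite divr_gt0// ltr_wpDl.
  exists (ln (1 + eta)); first by rewrite ln_gt0// ltrDl.
  pose w := (1 + eta)%:C *: z.
  have w0 j : w ord0 j != 0.
    rewrite mxE mulf_neq0// eq_complex/= negb_and.
    by rewrite gt_eqF// addr_gt0.
  have -> : Relog z + const_mx (ln (1 + eta)) = Relog w.
    apply/rowP => j; rewrite !mxE cmodM cmod_real; last by rewrite addr_ge0// ltW.
    by rewrite lnM ?posrE ?cmod_gt0 ?addr_gt0// addrC.
  rewrite -abs_seriesE//; apply: ze => j.
  rewrite mxE rmorphD mulrDl mul1r addrAC subrr add0r cmodM cmod_real ?ltW//.
  rewrite /eta mulrAC ltr_pdivrMr ?ltr_wpDl// ltr_pM2l//.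
  apply: le_lt_trans (_ : S < _); last by rewrite ltrDl.
  by rewrite /S (bigD1 j)//= lerDl sumr_ge0// => k _; exact: cmod_ge0.
move=> [e e0 fin].
pose z : 'rV[R[i]]_d := \row_j (expR (th ord0 j))%:C.
have zE j : cmod (z ord0 j) = expR (th ord0 j).
  by rewrite mxE cmod_real// expR_ge0.
exists z; last by apply/rowP => j; rewrite mxE zE expRK.
split; last first.
  by move=> j; rewrite mxE eq_complex/= negb_and gt_eqF// expR_gt0.
(* This radius is at most [expR (th_j) * (expR e - 1)] for every [j], so all moduli in the polydisc
   stay below [expR (th_j + e)]. *)
exists (expR (- l1norm th) * (expR e - 1)).
  by rewrite mulr_gt0 ?expR_gt0// subr_gt0 expR_gt1.
move=> w wz; rewrite /abs_conv_dom/=; apply: le_lt_trans fin.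
apply: le_esum => i _; rewrite lee_fin ler_wpM2l// expR_sum.
apply: ler_prod => j _; rewrite exprn_ge0 ?cmod_ge0//=.
rewrite !mxE expRM_natl lerXn2r ?nnegrE ?cmod_ge0 ?expR_ge0//.
rewrite -[w ord0 j](subrK (z ord0 j)) expRD.
apply: le_trans (cmodD _ _) _; rewrite zE.
rewrite -lerBrDr.
apply: le_trans (ltW (wz j)) _.
rewrite -{2}(mulr1 (expR (th ord0 j))) -mulrBr ler_wpM2r//.
  by rewrite subr_ge0 ltW// expR_gt1.
by rewrite ler_expR lerNl (le_trans _ (le_l1norm _ j))// ler_normr lexx orbT.
Qed.

Lemma OmegaG_down th th' : (forall j, th ord0 j <= th' ord0 j) ->
  OmegaG f th' -> OmegaG f th.
Proof.
move=> le /OmegaGP[e e0 fin]; apply/OmegaGP; exists e => //.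
by apply: le_lt_trans fin; apply: le_laplace => j; rewrite !mxE lerD2r.
Qed.

Lemma laplace_OmegaG th : OmegaG f th -> (laplace th < +oo)%E.
Proof.
move=> /OmegaGP[e e0]; apply: le_lt_trans; apply: le_laplace => j.
by rewrite !mxE lerDl ltW.
Qed.

Lemma OmegaG_nonempty : convD f !=set0 -> OmegaG f !=set0.
Proof.
move=> [z [e e0 ze]].
have e20 : 0 < e / 2 by rewrite divr_gt0.
(* Zero coordinates have no logarithm; moving them to [e / 2] stays within the neighbourhood of
   [z]. *)
pose w : 'rV[R[i]]_d := \row_j if z ord0 j == 0 then (e / 2)%:C else z ord0 j.
exists (Relog w - const_mx 1); apply/OmegaGP; exists 1 => //.
rewrite subrK -abs_seriesE.
  apply: ze => j; rewrite mxE; case: eqP => [->|_].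
    by rewrite subr0 cmod_real ?ltW// ltr_pdivrMr// ltr_pMr// ltr1n.
  by rewrite subrr cmod_real.
move=> j; rewrite mxE; case: (eqVneq (z ord0 j) 0) => // _.
by rewrite eq_complex/= negb_and gt_eqF.
Qed.

End log_domain.

(** * Growth along cones *)

Section continuity.
Variables (R : realType) (d : nat).

Lemma sum_continuous (T : topologicalType) (I : Type) (s : seq I)
  (F : I -> T -> R) : (forall i, continuous (F i)) ->
  continuous (fun x => \sum_(i <- s) F i x).
Proof.
move=> cF; elim: s => [|i s IH] x.
  by under eq_fun do rewrite big_nil; exact: cvg_cst.
under eq_fun do rewrite big_cons.
by apply: cvgD; [exact: cF|exact: IH].
Qed.

Lemma inner_continuous (th : 'rV[R]_d) : continuous (fun x => inner x th).
Proof.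
apply: sum_continuous => j x.
apply: continuousM; first exact: coord_continuous.
exact: cst_continuous.
Qed.

Lemma l1norm_continuous : continuous (@l1norm R d).
Proof.
apply: sum_continuous => j x.
apply: continuous_comp; first exact: coord_continuous.
exact: norm_continuous.
Qed.

(** These are the test cones for the growth at [x]: every [b] above [- <x, th> / |x|] gives one that
    contains [x]. *)
Lemma open_cone_halfspace (th : 'rV[R]_d) (b : R) :
  open_cone [set y | - inner y th < b * l1norm y].
Proof.
split; last first.
  move=> y t /= yC t0; rewrite innerZl l1normZ gtr0_norm// mulrCA -mulrN.
  by rewrite ltr_pM2l.
rewrite (_ : [set y | _] = (fun y => b * l1norm y + inner y th) @^-1` [set r | 0 < r]).
  apply: open_comp; last exact: open_gt.
  move=> y _.
  apply: (@continuousD R R^o _ (fun y => b * l1norm y) (fun y => inner y th));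
    last exact: inner_continuous.
  by apply: continuousM; [exact: cst_continuous|exact: l1norm_continuous].
by apply/seteqP; split=> y /=; rewrite -[_ < b * _]subr_gt0 opprK.
Qed.

End continuity.

Section growth.
Variables (R : realType) (d : nat) (f : 'rV[nat]_d -> R).
Hypothesis f0 : forall i, 0 <= f i.
Implicit Types (th x : 'rV[R]_d).

Lemma psiG_le_inner x th : OmegaG f th -> (psiG f x <= (- inner x th)%:E)%E.
Proof.
move=> /(laplace_OmegaG f0) Ffin; rewrite /psiG; case: eqP => [->|/eqP x0].
  by rewrite lee_fin /inner big1 ?oppr0// => j _; rewrite mxE mul0r.
have xp := l1norm_gt0 x0.
have F0 : (0 <= laplace f th)%E.
  by apply: esum_ge0 => i _; rewrite lee_fin mulr_ge0// expR_ge0.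
pose F := fine (laplace f th).
have FE : laplace f th = F%:E by rewrite fineK// ge0_fin_numE.
have {}F0 : 0 <= F by rewrite -lee_fin -FE.
apply/lee_addgt0Pr => e e0.
(* The slope [b] puts [x] strictly inside the test cone, and the larger slope [g] will bound the
   growth rate there. *)
pose b := (- inner x th + e / 2) / l1norm x.
pose g := (- inner x th + e) / l1norm x.
have bg : b < g.
  rewrite ltr_pM2r ?invr_gt0// ltrD2l ltr_pdivrMr// ltr_pMr//.
  by rewrite ltr1n.
have -> : ((- inner x th)%:E + e%:E = (l1norm x)%:E * g%:E)%E.
  by rewrite -EFinD -EFinM /g mulrC divfK// gt_eqF.
apply: lee_wpmul2l; first by rewrite lee_fin ltW.
apply: (@le_trans _ _ (tauC f [set y | - inner y th < b * l1norm y])).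
  apply: ereal_inf_lbound.
  exists [set y | - inner y th < b * l1norm y] => //.
  split; first exact: open_cone_halfspace.
  by rewrite /= /b divfK ?gt_eqF// ltrDl divr_gt0.
(* Beyond [r1] the constant terms are absorbed: [r * b + |b| + ln (F + 1) <= r * g]. Using [F + 1]
   keeps the logarithm defined and nonnegative when [F = 0]. *)
pose r1 := (`|b| + ln (F + 1)) / (g - b).
have lnF : 0 <= ln (F + 1) by rewrite ln_ge0// lerDr.
have r10 : 0 <= r1.
  by apply: divr_ge0; [exact: addr_ge0|rewrite subr_ge0 ltW].
apply: (@le_trans _ _ (ereal_sup _)).
  apply: ereal_inf_lbound.
  exists [set r : R | r1 < r]; last reflexivity.
  by exists r1; split => //; exact: num_real.
apply: ge_ereal_sup => _ [r /= r1r <-].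
have rp : 0 < r by exact: le_lt_trans r1r.
pose shell := [set i | - inner (natvec R i) th < b * l1norm (natvec R i) /\
  (r <= l1norm (natvec R i) <= r + 1)].
(* For [r <= |i| <= r + 1] one has [b * |i| <= r * b + |b|], whatever the sign of [b]. *)
pose K := expR (r * b + `|b|).
have SK : (\esum_(i in shell) (f i)%:E <= (K * (F + 1))%:E)%E.
  apply: (@le_trans _ _ (K%:E * laplace f th)%E); last first.
    by rewrite FE -EFinM lee_fin ler_wpM2l ?expR_ge0// lerDl.
  apply: le_trans; last first.
    apply: (esumZl_le (expR_ge0 _)) => i _.
    by rewrite lee_fin mulr_ge0// expR_ge0.
  apply: le_trans (le_esum_subset _ (@subsetT _ _)).
  apply: le_esum => i [iC /andP[ri ir]].
  rewrite -EFinM lee_fin mulrCA -expRD ler_peMr// -expR0 ler_expR.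
  rewrite -lerBlDr sub0r (le_trans (ltW iC))//.
  rewrite -lerBlDl (mulrC r) -mulrBr (le_trans (ler_norm _))// normrM.
  by rewrite ler_piMr// ger0_norm ?subr_ge0// lerBlDl.
have lS : (lne (\esum_(i in shell) (f i)%:E) <=
      (r * b + `|b| + ln (F + 1))%:E)%E.
  have F1 : 0 < F + 1 by rewrite ltr_wpDl.
  have -> : (r * b + `|b| + ln (F + 1))%:E = lne (K * (F + 1))%:E.
    by rewrite lne_EFin ?mulr_gt0 ?expR_gt0// lnM ?posrE ?expR_gt0// expRK.
  rewrite lee_lne// in_itv/= leey andbT; last first.
    by rewrite lee_fin mulr_ge0 ?expR_ge0// ltW.
  by apply: esum_ge0 => i _; rewrite lee_fin.
apply: (@le_trans _ _ ((r^-1)%:E * (r * b + `|b| + ln (F + 1))%:E)%E).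
  by rewrite lee_wpmul2l// lee_fin invr_ge0 ltW.
rewrite -EFinM lee_fin mulrC ler_pdivrMr// -addrA -lerBrDl (mulrC r) -mulrBl.
by rewrite mulrC -ler_pdivrMr ?subr_gt0// ltW.
Qed.

(** A nonnegative coefficient is at most the sum over the shell starting at its own norm, so the
    limsup bound on shells becomes a pointwise bound. *)
Lemma psiG_lt_bound x (s : R) : x != 0 -> (psiG f x < s%:E)%E ->
  exists (C : set 'rV[R]_d) (sg r0 : R), [/\ open_cone C, C x, sg * l1norm x < s &
    forall k, C (natvec R k) -> r0 <= l1norm (natvec R k) ->
      f k <= expR (sg * l1norm (natvec R k))].
Proof.
move=> x0; rewrite /psiG (negbTE x0) => psis.
have xp := l1norm_gt0 x0.
have : (ereal_inf [set tauC f C | C in [set C | open_cone C /\ C x]] <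
    (s / l1norm x)%:E)%E.
  by rewrite EFinM lte_pdivlMr// muleC.
move=> /ereal_inf_lt[_ [C [oC Cx] <-]].
move=> /ereal_inf_lt[_ [V [M [_ MV]] <-]].
set S := ereal_sup _ => Ss.
(* The supremum [S] may be [-oo], in which case any real number below [s / |x|] serves as [sg]. *)
have [sg sgs Ssg] : exists2 sg : R, sg < s / l1norm x & (S <= sg%:E)%E.
  move: Ss; case: S => [u us| |_]; first by exists u.
    by rewrite ltNge leey.
  by exists (s / l1norm x - 1); [rewrite gtrBl|rewrite leNye].
exists C, sg, (Num.max M 0 + 1); split => //; first by rewrite -ltr_pdivlMr.
move=> k Ck; set r := l1norm _ => rM.
have Mr : Num.max M 0 < r by apply: lt_le_trans rM; rewrite ltrDl.
move: Mr; rewrite gt_max => /andP[Mr rp].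
have [->|fk0] := eqVneq (f k) 0; first exact: expR_ge0.
have fk : 0 < f k by rewrite lt_def fk0 f0.
rewrite -(lnK fk) ler_expR -ler_pdivrMr// mulrC -lee_fin.
apply: le_trans Ssg; apply: le_trans (ereal_sup_ubound _); last first.
  by exists r => //; exact: MV.
rewrite EFinM; apply: lee_wpmul2l; first by rewrite lee_fin invr_ge0 ltW.
rewrite -lne_EFin//.
rewrite lee_lne ?in_itv/= ?leey ?lee_fin ?f0//; last first.
  by rewrite andbT; apply: esum_ge0 => i _; rewrite lee_fin.
apply: (esum_ge1 (fun i => (f i)%:E)); split=> //.
by rewrite lexx lerDl ler01.
Qed.

End growth.

(** * Superadditivity from concave growth *)

Section concave_growth.
Variables (R : realType) (d : nat) (f : 'rV[nat]_d -> R).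
Hypothesis f0 : forall i, 0 <= f i.
Variables a b c : R.
Hypotheses (a0 : 0 < a) (b0 : 0 < b) (c0 : 0 < c).
Hypothesis CG : forall x y : 'rV[R]_d,
  (c%:E * nuG f (l1ball x b) * nuG f (l1ball y b) <= nuG f (l1ball (x + y) a))%E.

Lemma coef_le_nuG i : ((f i)%:E <= nuG f (l1ball (natvec R i) b))%E.
Proof.
apply: (esum_ge1 (fun i => (f i)%:E)).
by rewrite /l1ball/= subrr /l1norm big1 ?ltW// => j _; rewrite mxE normr0.
Qed.

(* The mass of a ball of radius [a] around a lattice point is spread over
   boundedly many lattice points, so one of them carries a fixed fraction. *)
Lemma coef_supermultiplicative : exists2 c' : R, 0 < c' &
  forall i j, 0 < f i -> 0 < f j ->
    exists2 k, l1norm (natvec R k - (natvec R i + natvec R j)) <= a &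
      c' * f i * f j <= f k.
Proof.
have [M M0 Mle] := @lattice_sum_bounded R d 1 ltr01.
(* If every coefficient in the ball were below [mu], the mass of the ball would be at most
   [mu * expR a * M = c * f i * f j / 2], against (CG). *)
exists (c / (2 * (expR a * M))).
  by rewrite divr_gt0// !mulr_gt0// expR_gt0.
move=> i j fi fj.
set mu := _ * f i * f j.
have mu0 : 0 < mu by rewrite !mulr_gt0// invr_gt0 !mulr_gt0// expR_gt0.
set m := natvec R i + natvec R j.
have mE : m = natvec R (i + j) by apply/rowP => l; rewrite !mxE natrD.
apply: contrapT => nk.
have small k : l1norm (natvec R k - m) <= a -> f k < mu.
  by move=> ka; rewrite ltNge; apply/negP => le; apply: nk; exists k.
have : (c%:E * (f i)%:E * (f j)%:E <= (mu * expR a)%:E * M%:E)%E.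
  apply: le_trans (_ : _ <= nuG f (l1ball m a))%E _.
    apply: le_trans (CG _ _); apply: lee_pmul.
    - by rewrite -EFinM lee_fin mulr_ge0// ltW.
    - by rewrite lee_fin ltW.
    - apply: lee_pmul => //; last exact: coef_le_nuG.
        by rewrite lee_fin ltW.
      by rewrite lee_fin.
    - exact: coef_le_nuG.
  (* The indicator of the ball is dominated by [expR (a - |k - m|)], whose sum over the lattice is
     at most [expR a * M]. *)
  apply: le_trans; last first.
    by apply: lee_wpmul2l (Mle (i + j)); rewrite lee_fin mulr_ge0 ?expR_ge0 ?ltW.
  apply: le_trans; last first.
    by apply: esumZl_le => [|k _]; rewrite ?lee_fin ?expR_ge0// mulr_ge0 ?expR_ge0 ?ltW.
  apply: le_trans (le_esum_subset _ (@subsetT _ _)).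
  apply: le_esum => k; rewrite /l1ball/= -mE => ka.
  rewrite lee_fin (le_trans (ltW (small k ka)))//.
  rewrite -mulrA -expRD mulN1r ler_peMr ?(ltW mu0)// -expR0 ler_expR.
  by rewrite subr_ge0.
rewrite -!EFinM lee_fin leNgt => /negP; apply.
have -> : mu * expR a * M = c * f i * f j / 2.
  rewrite /mu; field.
  by rewrite !gt_eqF ?expR_gt0.
by rewrite ltr_pdivrMr// ltr_pMr ?ltr1n// !mulr_gt0.
Qed.

End concave_growth.

Section log_superadditive.
Variables (R : realType) (d : nat) (f : 'rV[nat]_d -> R) (a c' : R).
Hypotheses (a0 : 0 < a) (c'0 : 0 < c').
Hypothesis fM : forall i j, 0 < f i -> 0 < f j ->
    exists2 k, l1norm (natvec R k - (natvec R i + natvec R j)) <= a &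
      c' * f i * f j <= f k.

(** Adding [ln c'] to [ln (f i)] absorbs the constant of [fM], so the values add up with no loss,
    while each merge shifts the index by at most [a]. *)
Lemma seq_supermultiplicative (s : seq 'rV[nat]_d) : s != [::] -> {in s, forall i, 0 < f i} ->
  exists k, [/\ 0 < f k,
    l1norm (natvec R k - \sum_(i <- s) natvec R i) <= a * (size s)%:R &
    \sum_(i <- s) (ln (f i) + ln c') <= ln (f k) + ln c'].
Proof.
elim: s => // i s IH _ fs.
have fi : 0 < f i by apply: fs; rewrite mem_head.
have [->|s0] := eqVneq s [::].
  exists i; rewrite !big_seq1 subrr mulr1; split => //.
  by rewrite /l1norm big1 ?ltW// => j _; rewrite mxE normr0.
have [j js|k [fk ks Lk]] := IH s0; first by apply: fs; rewrite inE js orbT.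
have [k' k'a fk'] := fM fi fk.
have fk'0 : 0 < f k' by apply: lt_le_trans fk'; rewrite !mulr_gt0.
exists k'; split => //.
  rewrite big_cons.
  rewrite (_ : _ - _ = (natvec R k' - (natvec R i + natvec R k)) +
    (natvec R k - \sum_(j <- s) natvec R j)); last first.
    by rewrite !opprD !addrA subrK.
  rewrite (le_trans (l1normD _ _))// (le_trans (lerD k'a ks))//.
  by rewrite /= -natr1 mulrDr mulr1 addrC.
rewrite big_cons (le_trans (lerD (lexx _) Lk))//.
rewrite addrA lerD2r addrAC addrC addrA -lnM ?posrE// -lnM ?posrE ?mulr_gt0//.
by rewrite ler_ln ?posrE ?mulr_gt0// (mulrAC (f k)) mulrC mulrA mulrAC.
Qed.

End log_superadditive.

(** * Separation from a rational cone *)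

Section separation.
Variables (R : realType) (n : nat).
Implicit Types (E : set 'rV[R]_n) (p q v w : 'rV[R]_n).

Lemma le0_archi (x y : R) : (forall m : nat, x <= m.+2%:R^-1 * y) -> x <= 0.
Proof.
move=> h; rewrite leNgt; apply/negP => x0.
have /archi_boundP : 0 <= `|y| / x by rewrite divr_ge0// ltW.
set m := Num.bound _ => ym.
have := h m; rewrite mulrC ler_pdivlMr// leNgt => /negP; apply.
apply: le_lt_trans (ler_norm y) _.
rewrite mulrC -ltr_pdivrMr//; apply: lt_trans ym _.
by rewrite ltr_nat ltnS leqnSn.
Qed.

Lemma inner_sqrD w (r : R) q :
  inner (w + r *: q) (w + r *: q) = inner w w + 2 * r * inner q w + r ^+ 2 * inner q q.
Proof.
by rewrite innerDl !innerDr !innerZl !innerZr (innerC w q); ring.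
Qed.

Lemma closure_l1norm E p (e : R) : closure E p -> 0 < e ->
  exists2 q, E q & l1norm (q - p) < e.
Proof.
move=> Ep e0.
have nb : nbhs p [set q | l1norm (q - p) < e].
  apply: open_nbhs_nbhs; split; last first.
    by rewrite /= subrr /l1norm big1// => j _; rewrite mxE normr0.
  apply: (@open_comp _ _ (fun q => l1norm (q - p)) [set r | r < e]).
    move=> q _; apply: continuous_comp; last exact: l1norm_continuous.
    by apply: continuousB; [move=> ?; exact: cvg_id|exact: cst_continuous].
  exact: open_lt.
by have [q [Eq qp]] := Ep _ nb; exists q.
Qed.

Lemma l1norm_closure E p :
  (forall e : R, 0 < e -> exists2 q, E q & l1norm (q - p) < e) -> closure E p.
Proof.
move=> h B /nbhs_ballP[e /= e0 eB]; have [q Eq qp] := h e e0.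
exists q; split => //; apply: eB; split => // i j.
rewrite ord1; apply: le_lt_trans qp.
by rewrite -normrN opprB; have := le_l1norm (q - p) j; rewrite !mxE.
Qed.

Lemma closure_map E (F : 'rV[R]_n -> 'rV[R]_n) p : continuous F ->
  (forall q, E q -> E (F q)) -> closure E p -> closure E (F p).
Proof.
move=> cF EF Ep B FB; have [q [Eq qB]] := Ep _ (cF _ _ FB).
by exists (F q); split => //; exact: EF.
Qed.

(** The squared Euclidean distance to [v] is minimised over a sublevel set in the closure, which is
    compact. *)
Lemma closure_nearest E v : E !=set0 -> exists2 p, closure E p &
  forall q, closure E q -> inner (v - p) (v - p) <= inner (v - q) (v - q).
Proof.
move=> [p0 Ep0]; pose g p := inner (v - p) (v - p).
have gc : continuous g.
  apply: sum_continuous => j p.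
  have cj : {for p, continuous (fun p : 'rV[R]_n => (v - p) ord0 j)}.
    apply: (@continuous_comp _ _ _ (fun p => v - p) (fun p : 'rV[R]_n => p ord0 j)).
      by apply: continuousB; [exact: cst_continuous|move=> ?; exact: cvg_id].
    exact: coord_continuous.
  exact: (continuousM cj cj).
pose A := closure E `&` (g @^-1` [set r | r <= g p0]).
have Ap0 : A p0 by split; [exact: subset_closure|rewrite /= lexx].
have Ac : compact A.
  apply: bounded_closed_compact; last first.
    apply: closedI; first exact: closed_closure.
    by apply: preimage_closed; [move=> ? _; exact: gc|exact: closed_le].
  exists (l1norm v + (g p0 + 1)); split; first exact: num_real.
  move=> M ltM p [_ /= gp].
  have M0 : 0 <= M.
    apply: le_trans (ltW ltM); rewrite addr_ge0 ?l1norm_ge0// addr_ge0//.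
    by apply: sumr_ge0 => j _; rewrite -expr2 sqr_ge0.
  rewrite /Num.Def.normr/= mx_normrE; apply/bigmax_leP; split => // -[i j] _ /=.
  rewrite ord1; apply: le_trans (ltW ltM).
  rewrite -[p ord0 j](subKr (v ord0 j)) (le_trans (ler_normB _ _))//.
  apply: lerD; first exact: le_l1norm.
  set u := v ord0 j - p ord0 j.
  have : u ^+ 2 <= g p0.
    apply: le_trans gp; rewrite /g /inner (bigD1 j)//= !mxE -expr2 lerDl.
    by apply: sumr_ge0 => k _; rewrite -expr2 sqr_ge0.
  rewrite -real_normK ?num_real// => ug.
  (* This square gives [2 * |u| <= u ^+ 2 + 1], hence [|u| <= g p0 + 1]. *)
  have := sqr_ge0 (`|u| - 1); rewrite sqrrB1.
  by have := normr_ge0 u; lra.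
have [p] := EVT_min_rV (ex_intro _ _ Ap0) Ac (continuous_subspaceT gc).
rewrite inE => -[Ep gp] pmin; exists p => // q Eq.
have [qp0|/ltW p0q] := leP (g q) (g p0); last exact: le_trans p0q.
by apply: pmin; rewrite inE; split.
Qed.

(** The normal is [w = v - p], with [p] the point of the closure nearest to [v]. Moving [p] within
    the closure along [q], or towards the origin, cannot bring it closer to [v]; steps of size
    [1 / (m + 2)] suffice, so rational multiples are enough. *)
Lemma cone_separation E v (e : R) : E !=set0 ->
  (forall p q, E p -> E q -> E (p + q)) ->
  (forall q (m : nat), E q -> E (m.+1%:R^-1 *: q)) ->
  0 < e -> (forall q, E q -> e <= l1norm (q - v)) ->
  exists2 w, forall q, E q -> inner q w <= 0 & 0 < inner v w.
Proof.
move=> E0 ED EV e0 Ev; have [p Ep pmin] := closure_nearest v E0.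
pose w := v - p; exists w.
  move=> q Eq; have -> : inner q w = (2 * inner q w) / 2 by field.
  rewrite pmulr_lle0 ?invr_gt0//; apply: (@le0_archi _ (inner q q)) => m.
  set r : R := m.+2%:R^-1; have r0 : 0 < r by rewrite invr_gt0.
  have : closure E (p + r *: q).
    apply: (closure_map (F := fun p => p + r *: q)) Ep => //.
      move=> x; apply: (@continuousD R _ _ id (fun=> r *: q)); [exact: cvg_id|exact: cst_continuous].
    by move=> p' Ep'; apply: ED => //; exact: EV.
  (* Minimality reads [2 * <q, w> <= r * <q, q>], and [r] is arbitrarily small. *)
  move=> /pmin; rewrite opprD addrA -/w.
  rewrite -scaleNr inner_sqrD.
  set a := inner w w; set b := inner q w; set c := inner q q => h.
  rewrite -(ler_pM2l r0); lra.
have pw : 0 <= inner p w.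
  have -> : inner p w = - ((- 2 * inner p w) / 2) by field.
  rewrite oppr_ge0 pmulr_lle0 ?invr_gt0//; apply: (@le0_archi _ (inner p p)) => m.
  set r : R := m.+2%:R^-1; have r0 : 0 < r by rewrite invr_gt0.
  (* The factor [1 - r = (m + 1) / (m + 2)] is a positive rational, which preserves [E]. *)
  have : closure E ((1 - r) *: p).
    have -> : (1 - r) *: p = m.+1%:R *: (r *: p).
      by rewrite scalerA; congr (_ *: _); rewrite /r; field.
    apply: (closure_map (F := fun p => m.+1%:R *: (r *: p))) Ep => //.
      by move=> x; under eq_fun do rewrite scalerA; exact: scaler_continuous.
    move=> q Eq; elim: {1}m => [|k IH]; first by rewrite scale1r; exact: EV.
    by rewrite -natr1 scalerDl scale1r; apply: ED => //; exact: EV.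
  have -> : (1 - r) *: p = p - r *: p by rewrite scalerBl scale1r.
  move=> /pmin; rewrite opprB addrCA addrC -/w inner_sqrD.
  set a := inner w w; set b := inner p w; set c := inner p p => h.
  rewrite -(ler_pM2l r0); lra.
have -> : inner v w = inner w w + inner p w by rewrite -innerDl subrK.
rewrite ltr_wpDr// lt_def; apply/andP; split; last first.
  by apply: sumr_ge0 => j _; rewrite -expr2 sqr_ge0.
apply/eqP => ww.
have pv : v = p.
  apply/rowP => j; apply/eqP; rewrite -subr_eq0 -sqrf_eq0 eq_le sqr_ge0 andbT.
  rewrite -ww /inner (bigD1 j)//= !mxE -expr2 lerDl.
  by apply: sumr_ge0 => k _; rewrite -expr2 sqr_ge0.
have [q Eq] := closure_l1norm Ep e0.
by rewrite -pv ltNge Ev.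
Qed.

End separation.

Section repeated_sequence.
Variable I : eqType.

Lemma mem_flatten_nseq (s : seq I) m i : i \in flatten (nseq m s) -> i \in s.
Proof. by move=> /flattenP[s' /nseqP[-> _]]. Qed.

Lemma big_flatten_nseq (V : zmodType) (s : seq I) m (F : I -> V) :
  \sum_(i <- flatten (nseq m s)) F i = (\sum_(i <- s) F i) *+ m.
Proof.
elim: m => [|m IH]; first by rewrite big_nil.
by rewrite /= big_cat/= IH mulrS.
Qed.

End repeated_sequence.

Section split_last.
Variables (R : realType) (d : nat).
Implicit Types q w : 'rV[R]_(d + 1).

Definition last_coord q : R := q ord0 (rshift d ord0).

Lemma l1norm_split q : l1norm q = l1norm (lsubmx q) + `|last_coord q|.
Proof.
rewrite /l1norm big_split_ord/= big_ord1; congr (_ + _).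
by apply: eq_bigr => j _; rewrite mxE.
Qed.

Lemma inner_split q w :
  inner q w = inner (lsubmx q) (lsubmx w) + last_coord q * last_coord w.
Proof.
rewrite /inner big_split_ord/= big_ord1; congr (_ + _).
by apply: eq_bigr => j _; rewrite !mxE.
Qed.

Lemma last_coord_row_mx (y : 'rV[R]_d) t : last_coord (row_mx y (const_mx t)) = t.
Proof. by rewrite /last_coord row_mxEr mxE. Qed.

End split_last.

(** * The rational cone of lattice points and logarithmic coefficients *)

Section growth_cone.
Variables (R : realType) (d : nat) (f : 'rV[nat]_d -> R) (c' rr : R).

(** A nonnegative rational combination is encoded by a common denominator [N] and a list whose
    repetitions are the integer weights, the form in which superadditivity along lists applies. *)
Definition growth_cone : set 'rV[R]_(d + 1) :=
  [set q | exists (N : nat) (s : seq 'rV[nat]_d), [/\ (0 < N)%N,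
     {in s, forall i, 0 < f i /\ rr <= l1norm (natvec R i)},
     N%:R *: lsubmx q = \sum_(i <- s) natvec R i &
     N%:R * last_coord q <= \sum_(i <- s) (ln (f i) + ln c')]].

Lemma growth_coneD p q : growth_cone p -> growth_cone q -> growth_cone (p + q).
Proof.
move=> [N [s [N0 sP sE sL]]] [N' [s' [N'0 s'P s'E s'L]]].
exists (N * N')%N, (flatten (nseq N' s) ++ flatten (nseq N s')); split.
- by rewrite muln_gt0 N0.
- by move=> i; rewrite mem_cat => /orP[] /mem_flatten_nseq; [exact: sP|exact: s'P].
- rewrite big_cat/= !big_flatten_nseq -sE -s'E linearD/= scalerDr natrM.
  rewrite -[X in _ = X + _]scaler_nat -[X in _ = _ + X]scaler_nat !scalerA.
  by rewrite (mulrC N'%:R).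
- rewrite big_cat/= !big_flatten_nseq.
  have -> : last_coord (p + q) = last_coord p + last_coord q.
    by rewrite /last_coord mxE.
  rewrite natrM mulrDr; apply: lerD.
    by rewrite mulrAC -[leRHS]mulr_natr ler_wpM2r.
  by rewrite mulrC mulrCA -[leRHS]mulr_natl ler_wpM2l// mulrC.
Qed.

Lemma growth_coneV q (m : nat) : growth_cone q -> growth_cone (m.+1%:R^-1 *: q).
Proof.
move=> [N [s [N0 sP sE sL]]]; exists (N * m.+1)%N, s; split => //.
- by rewrite muln_gt0 N0.
- by rewrite linearZ/= scalerA natrM mulfK// pnatr_eq0.
- rewrite (_ : last_coord _ = m.+1%:R^-1 * last_coord q); last by rewrite /last_coord mxE.
  by rewrite mulrA natrM mulfK// pnatr_eq0.
Qed.

(** The empty list yields this ray. It makes the cone nonempty and forces a separating normal to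
    have a nonnegative last coordinate. *)
Lemma growth_cone_down (t : R) : t <= 0 -> growth_cone (row_mx 0 (const_mx t)).
Proof.
move=> t0; exists 1, [::]; split => //.
  by rewrite row_mxKl scaler0 big_nil.
by rewrite last_coord_row_mx big_nil mul1r.
Qed.

Lemma growth_cone_coef i : 0 < f i -> rr <= l1norm (natvec R i) ->
  growth_cone (row_mx (natvec R i) (const_mx (ln (f i) + ln c'))).
Proof.
move=> fi ri; exists 1, [:: i]; split => //.
- by move=> j; rewrite inE => /eqP->.
- by rewrite row_mxKl scale1r big_seq1.
- by rewrite last_coord_row_mx big_seq1 mul1r.
Qed.

(** The l1 norm is additive on nonnegative vectors. This bounds the number of summands, hence the
    accumulated index error, by the norm of the sum. *)
Lemma l1norm_sum_natvec (s : seq 'rV[nat]_d) :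
  {in s, forall i, rr <= l1norm (natvec R i)} ->
  rr * (size s)%:R <= l1norm (\sum_(i <- s) natvec R i).
Proof.
have nn (t : seq 'rV[nat]_d) j : 0 <= (\sum_(i <- t) natvec R i) ord0 j.
  by rewrite summxE sumr_ge0// => i _; exact: natvec_ge0.
elim: s => [|i s IH] h; first by rewrite mulr0 l1norm_ge0.
rewrite l1norm_nneg//= big_cons -natr1 mulrDr mulr1 addrC.
under eq_bigr do rewrite mxE.
rewrite big_split/= -!l1norm_nneg//; last by move=> j; exact: natvec_ge0.
apply: lerD; first by apply: h; rewrite mem_head.
by apply: IH => j js; apply: h; rewrite inE js orbT.
Qed.

End growth_cone.

Section separate_growth_cone.
Variables (R : realType) (d : nat) (f : 'rV[nat]_d -> R) (a c' : R).
Hypotheses (f0 : forall i, 0 <= f i) (a0 : 0 < a) (c'0 : 0 < c').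
Hypothesis fM : forall i j, 0 < f i -> 0 < f j ->
    exists2 k, l1norm (natvec R k - (natvec R i + natvec R j)) <= a &
      c' * f i * f j <= f k.

Lemma open_l1ball (C : set 'rV[R]_d) x : open C -> C x ->
  exists2 e : R, 0 < e & forall y, l1norm (y - x) < e -> C y.
Proof.
move=> oC Cx; have /nbhs_ballP[e /= e0 eC] := open_nbhs_nbhs (conj oC Cx).
exists e => // y yx; apply: eC; split => // i j; rewrite ord1.
apply: le_lt_trans yx; rewrite -normrN opprB.
by have := le_l1norm (y - x) j; rewrite !mxE.
Qed.

(* A point of the cone near [(x, s)] would yield, by superadditivity, arbitrarily
   large lattice points [k] in direction close to [x] with [ln (f k)] about
   [s |k| / |x|], contradicting the growth bound. *)
Lemma growth_cone_far (x : 'rV[R]_d) (s : R) : x != 0 -> (psiG f x < s%:E)%E ->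
  exists rr e : R, 0 < e /\
    forall q, growth_cone f c' rr q -> e <= l1norm (q - row_mx x (const_mx s)).
Proof.
move=> x0 /(psiG_lt_bound f0 x0)[C [sg [r0 [[oC coneC] Cx sgx fC]]]].
have xp := l1norm_gt0 x0; set X := l1norm x in xp sgx *.
have [rho rho0 rhoC] := open_l1ball oC Cx.
pose gap := s - sg * X.
have gap0 : 0 < gap by rewrite subr_gt0.
(* The three bounds keep directions within [e] of [x] inside [C], keep their norms at least [X / 2],
   and limit the resulting change of [sg * |.|] to [gap / 4]. *)
have [e [e0 erho eX esg]] : exists e : R, [/\ 0 < e, e < rho, e <= X / 2 &
    `|sg| * e <= gap / 4].
  exists (Num.min (rho / 2) (Num.min (X / 2) (gap / 4 / (`|sg| + 1)))).
  have sg1 : 0 < `|sg| + 1 by rewrite ltr_wpDl.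
  split.
  - by rewrite !lt_min !divr_gt0.
  - by rewrite gt_min ltr_pdivrMr// ltr_pMr// ltr1n.
  - by rewrite !ge_min lexx orbT.
  - apply: (@le_trans _ _ (`|sg| * (gap / 4 / (`|sg| + 1)))).
      by rewrite ler_wpM2l// !ge_min lexx !orbT.
    rewrite mulrCA ler_piMr//; first by rewrite divr_ge0// ltW.
    by rewrite ler_pdivrMr// mul1r lerDl.
(* With [rr * size l <= N * (X + e)], the index error [a * size l] is at most [N * e / 2]. *)
pose rr := 2 * a * (X + e) / e.
have rr0 : 0 < rr by rewrite divr_gt0// !mulr_gt0// addr_gt0.
pose e1 := Num.min (e / 2) (gap / 4).
have e10 : 0 < e1 by rewrite lt_min !divr_gt0.
have e1e : e1 <= e / 2 by rewrite ge_min lexx.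
have e1g : e1 <= gap / 4 by rewrite ge_min lexx orbT.
exists rr, e1; split => // q [N [l [N0 lP lE lL]]].
rewrite leNgt; apply/negP; rewrite l1norm_split.
have -> : lsubmx (q - row_mx x (const_mx s)) = lsubmx q - x.
  by rewrite linearB/= row_mxKl.
have -> : last_coord (q - row_mx x (const_mx s)) = last_coord q - s.
  by rewrite -[in RHS](last_coord_row_mx x s) /last_coord !mxE.
set y := lsubmx q in lE *; set t := last_coord q in lL * => close.
have yx : l1norm (y - x) < e1 by apply: le_lt_trans close; rewrite lerDl.
have ts : s - e1 < t.
  have : `|t - s| < e1 by apply: le_lt_trans close; rewrite lerDr l1norm_ge0.
  by rewrite ltr_distl => /andP[].
have yX : l1norm y <= X + e.
  rewrite -[y](subrK x) addrC (le_trans (l1normD _ _))// lerD2l.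
  by rewrite (le_trans (ltW yx))// (le_trans e1e)// ler_pdivrMr// ler_peMr ?ler1n// ltW.
have NR : 0 < N%:R :> R by rewrite ltr0n.
(* An empty list would give [y = 0], at distance [X > e1] from [x]. *)
have l0 : l != [::].
  apply/eqP => l0; move: lE; rewrite l0 big_nil => /eqP.
  rewrite scaler_eq0 gt_eqF//= => /eqP y0.
  by move: yx; rewrite y0 sub0r l1normN -/X; lra.
have szl : rr * (size l)%:R <= N%:R * l1norm y.
  have -> : N%:R * l1norm y = l1norm (\sum_(i <- l) natvec R i).
    by rewrite -lE l1normZ gtr0_norm.
  by apply: l1norm_sum_natvec => i /lP[].
(* Repeating [l] often enough pushes the lattice point beyond [r0] and makes [ln c'] smaller than
   [T * gap / 2]. *)
pose M := Num.bound (`|r0| * 2 / X + `|ln c'| * 2 / gap).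
pose T : R := (N * M.+1)%:R.
have T0 : 0 < T by rewrite ltr0n muln_gt0 N0.
have TM : `|r0| * 2 / X + `|ln c'| * 2 / gap < T.
  apply: lt_le_trans (archi_boundP _) _.
    by rewrite addr_ge0// divr_ge0 ?mulr_ge0// ltW.
  by rewrite ler_nat (leq_trans (leqnSn _))// leq_pmull.
have Tr0 : r0 < T * (X / 2).
  rewrite -ltr_pdivrMr ?divr_gt0//.
  apply: le_lt_trans TM; rewrite invf_div mulrA -[leLHS]addr0.
  apply: lerD; last by rewrite divr_ge0 ?mulr_ge0// ltW.
  by rewrite ler_pM2r ?invr_gt0// ler_pM2r// ler_norm.
have Tlc : ln c' < T * (gap / 2).
  rewrite -ltr_pdivrMr ?divr_gt0//.
  apply: le_lt_trans TM; rewrite invf_div mulrA -[leLHS]add0r.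
  apply: lerD; first by rewrite divr_ge0 ?mulr_ge0// ltW.
  by rewrite ler_pM2r ?invr_gt0// ler_pM2r// ler_norm.
have [||k [fk kl Lk]] := seq_supermultiplicative a0 c'0 fM (s := flatten (nseq M.+1 l)).
- by case: (l) l0.
- by move=> i /mem_flatten_nseq /lP[].
move: kl Lk; rewrite !big_flatten_nseq -lE.
rewrite size_flatten /shape map_nseq sumn_nseq => kl Lk.
have kT : l1norm (natvec R k - T *: y) <= T * (e / 2).
  move: kl; rewrite -scaler_nat scalerA -natrM mulnC -/T => /le_trans; apply.
  have Xe : 0 < X + e by exact: addr_gt0.
  rewrite natrM -(ler_pM2r Xe).
  have -> : a * ((size l)%:R * M.+1%:R) * (X + e) =
      rr * (size l)%:R * (M.+1%:R * (e / 2)).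
    by rewrite /rr; field; rewrite gt_eqF.
  have -> : T * (e / 2) * (X + e) = N%:R * (X + e) * (M.+1%:R * (e / 2)).
    by rewrite /T natrM; ring.
  rewrite ler_wpM2r//; first by rewrite mulr_ge0// ltW// divr_gt0.
  by apply: le_trans szl _; rewrite ler_wpM2l.
have kx : l1norm (natvec R k - T *: x) <= T * e.
  rewrite -(subrK (T *: y) (natvec R k)) -addrA -scalerBr.
  apply: le_trans (l1normD _ _) _; rewrite l1normZ gtr0_norm//.
  have -> : T * e = T * (e / 2) + T * (e / 2) by field.
  by apply: lerD => //; rewrite ler_pM2l// (le_trans (ltW yx)).
have Ck : C (natvec R k).
  have -> : natvec R k = T *: (T^-1 *: natvec R k).
    by rewrite scalerA mulfV ?scale1r// gt_eqF.
  apply: coneC => //; apply: rhoC.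
  have -> : T^-1 *: natvec R k - x = T^-1 *: (natvec R k - T *: x).
    by rewrite scalerBr scalerA mulVf ?scale1r// gt_eqF.
  rewrite l1normZ gtr0_norm ?invr_gt0// mulrC ltr_pdivrMr// mulrC.
  by rewrite (le_lt_trans kx)// ltr_pM2l.
have kX : `|l1norm (natvec R k) - T * X| <= T * e.
  by apply: le_trans kx; rewrite -[T in T * X]gtr0_norm// -l1normZ ler_dist_l1norm.
have kr0 : r0 <= l1norm (natvec R k).
  move: kX; rewrite ler_distl => /andP[kX _]; apply: le_trans kX.
  apply: le_trans (ltW Tr0) _; rewrite -mulrBr ler_pM2l//; lra.
have := fC k Ck kr0; rewrite -[f k]lnK ?posrE// ler_expR => lnk.
have sgk : sg * l1norm (natvec R k) <= T * (sg * X + gap / 4).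
  have -> : sg * l1norm (natvec R k) =
      T * (sg * X) + sg * (l1norm (natvec R k) - T * X) by ring.
  rewrite [T * (sg * X + _)]mulrDr lerD2l.
  apply: le_trans (ler_norm _) _; rewrite normrM.
  apply: le_trans (_ : `|sg| * (T * e) <= _); first by rewrite ler_wpM2l.
  by rewrite mulrCA ler_pM2l.
have Tt : T * t <= ln (f k) + ln c'.
  apply: le_trans Lk; rewrite -mulr_natl /T natrM mulrAC mulrC ler_pM2l//.
(* Now [T * t] is at least [T * (sg * X + 3 * gap / 4)], while the growth bound and [Tlc] put it
   strictly below that number. *)
have : T * (s - e1) <= T * t by rewrite ler_pM2l// ltW.
have : T * e1 <= T * (gap / 4) by rewrite ler_pM2l.
have -> : T * (s - e1) = T * gap + T * (sg * X) - T * e1 by rewrite /gap; ring.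
move: Tt sgk Tlc lnk; rewrite mulrDr !(mulrA T gap) ; lra.
Qed.

End separate_growth_cone.

(** * Duality *)

Section duality.
Variables (R : realType) (d : nat) (f : 'rV[nat]_d -> R).
Hypothesis f0 : forall i, 0 <= f i.
Implicit Types (th x : 'rV[R]_d) (i : 'rV[nat]_d).

Lemma sum_natvec i : \sum_j natvec R i ord0 j = l1norm (natvec R i).
Proof. by rewrite l1norm_nneg// => j; exact: natvec_ge0. Qed.

(** Lowering [th] by [e] gains a factor [expR (- e * |i|)]: one half makes the series converge, the
    other leaves the room asked for by [OmegaGP]. *)
Lemma bounded_coef_OmegaG th (K e : R) :
  (forall i, f i * expR (inner (natvec R i) th) <= K) -> 0 < e ->
  OmegaG f (th - const_mx e).
Proof.
move=> fK e0; have K0 : 0 <= K.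
  by apply: le_trans (fK 0); rewrite mulr_ge0// expR_ge0.
have e20 : 0 < e / 2 by rewrite divr_gt0.
have [M M0 Mle] := lattice_sum_bounded d e20.
apply/(OmegaGP f0); exists (e / 2) => //.
apply: (@le_lt_trans _ _ (K%:E * M%:E)%E); last by rewrite -EFinM ltry.
apply: le_trans (lee_wpmul2l _ (Mle 0)); last by rewrite lee_fin.
apply: le_trans; last first.
  by apply: esumZl_le => // i _; rewrite lee_fin expR_ge0.
apply: le_esum => i _; rewrite -EFinM lee_fin.
have -> : natvec R 0 = 0 :> 'rV[R]_d by apply/rowP => j; rewrite !mxE.
rewrite subr0 !innerDr innerNr !inner_const_mx sum_natvec -addrA expRD mulrA.
have -> : - (l1norm (natvec R i) * e) + l1norm (natvec R i) * (e / 2) =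
    - (e / 2) * l1norm (natvec R i) by field.
by rewrite ler_wpM2r// expR_ge0.
Qed.

Lemma laplace_coef th : OmegaG f th ->
  exists K, forall i, f i * expR (inner (natvec R i) th) <= K.
Proof.
move=> /(laplace_OmegaG f0) fin; exists (fine (laplace f th)) => i.
rewrite -lee_fin fineK; last first.
  rewrite ge0_fin_numE//; apply: esum_ge0 => k _.
  by rewrite lee_fin mulr_ge0// expR_ge0.
exact: (esum_ge1 (fun i => (f i * expR (inner (natvec R i) th))%:E)).
Qed.

Lemma le_expR_inner i th (rr : R) : l1norm (natvec R i) <= rr ->
  expR (inner (natvec R i) th) <= expR (rr * l1norm th).
Proof.
move=> ir; rewrite ler_expR (le_trans (ler_norm _))// (le_trans (ler_norm_inner _ _))//.
by rewrite ler_wpM2r// l1norm_ge0.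
Qed.

(** Along [th] the terms with [|i| >= rr] do not grow, and the others grow by at most the constant
    factor [K]. This serves the case of a separating normal with zero last coordinate. *)
Lemma OmegaG_vertical th0 th (rr T : R) : OmegaG f th0 -> 0 <= T ->
  (forall i, 0 < f i -> rr <= l1norm (natvec R i) -> inner (natvec R i) th <= 0) ->
  OmegaG f (th0 + T *: th).
Proof.
move=> /(OmegaGP f0)[e e0 fin] T0 neg; apply/(OmegaGP f0); exists e => //.
pose K := expR (`|rr| * l1norm (T *: th)).
apply: (@le_lt_trans _ _ (K%:E * laplace f (th0 + const_mx e))%E); last first.
  by rewrite lte_mul_pinfty// lee_fin expR_ge0.
apply: le_trans; last first.
  apply: esumZl_le => [|i _]; first exact: expR_ge0.
  by rewrite lee_fin mulr_ge0// expR_ge0.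
apply: le_esum => i _; rewrite -EFinM lee_fin.
have [->|fi0] := eqVneq (f i) 0; first by rewrite !mul0r mulr0.
have fi : 0 < f i by rewrite lt_def fi0 f0.
rewrite addrAC [inner _ (_ + T *: _)]innerDr expRD mulrA mulrC ler_wpM2r//.
  by rewrite mulr_ge0// expR_ge0.
have [ri|/ltW ir] := leP rr (l1norm (natvec R i)).
  apply: le_trans (_ : 1 <= _); last by rewrite -expR0 ler_expR mulr_ge0// l1norm_ge0.
  by rewrite -expR0 ler_expR innerZr mulr_ge0_le0// neg.
by apply: le_expR_inner; rewrite (le_trans ir)// ler_norm.
Qed.

Lemma psiG_lt_witness (a c' s : R) x : 0 < a -> 0 < c' ->
  (forall i j, 0 < f i -> 0 < f j ->
    exists2 k, l1norm (natvec R k - (natvec R i + natvec R j)) <= a &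
      c' * f i * f j <= f k) ->
  OmegaG f !=set0 -> x != 0 -> (psiG f x < (- s)%:E)%E ->
  exists2 th, OmegaG f th & s <= inner x th.
Proof.
move=> a0 c'0 fM [th0 Oth0] x0 psis.
have [rr [e [e0 far]]] := growth_cone_far f0 a0 c'0 fM x0 psis.
have [w wE] := cone_separation
  (ex_intro _ _ (growth_cone_down f c' rr (lexx 0)))
  (@growth_coneD _ _ f c' rr) (@growth_coneV _ _ f c' rr) e0 far.
rewrite inner_split row_mxKl last_coord_row_mx.
set th := lsubmx w; set la := last_coord w => wx.
have la0 : 0 <= la.
  have := wE _ (growth_cone_down f c' rr (lerN10 R)).
  rewrite inner_split row_mxKl last_coord_row_mx mulN1r.
  by rewrite /inner big1 ?add0r ?oppr_le0// => j _; rewrite mxE mul0r.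
have wi i : 0 < f i -> rr <= l1norm (natvec R i) ->
    inner (natvec R i) th + (ln (f i) + ln c') * la <= 0.
  move=> fi ri; have := wE _ (growth_cone_coef c' fi ri).
  by rewrite inner_split row_mxKl last_coord_row_mx.
move: la0; rewrite le_eqVlt => /orP[/eqP la0|la0].
  rewrite -la0 mulr0 addr0 in wx.
  (* Moving by [T] along [th] raises [<x, .>] from its value at [th0] to at least [s]. *)
  pose T := `|s - inner x th0| / inner x th.
  exists (th0 + T *: th).
    apply: (@OmegaG_vertical _ _ rr) => //; first by rewrite divr_ge0// ltW.
    by move=> i fi ri; have := wi i fi ri; rewrite -la0 mulr0 addr0.
  by rewrite innerDr innerZr divfK ?gt_eqF// -lerBlDl ler_norm.
pose th1 := la^-1 *: th.
have xth1 : s < inner x th1.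
  by rewrite innerZr mulrC ltr_pdivlMr// -subr_gt0 -mulNr.
have [K0 K0le] := laplace_coef Oth0.
(* The first summand covers [|i| <= rr], by comparison with [th0]; the second covers [|i| >= rr],
   where separation gives [f i * expR <i, th1> <= 1 / c']. *)
pose K := `|K0| * expR (`|rr| * l1norm (th1 - th0)) + c'^-1.
(* Lowering [th1] by [e1] costs at most [|x| * e1], which fits in the slack [<x, th1> - s]. *)
pose e1 := (inner x th1 - s) / (l1norm x + 1).
have X1 : 0 < l1norm x + 1 by rewrite ltr_wpDl// l1norm_ge0.
have e10 : 0 < e1 by rewrite divr_gt0// subr_gt0.
exists (th1 - const_mx e1); last first.
  rewrite innerDr innerNr inner_const_mx lerBrDr -lerBrDl.
  apply: (@le_trans _ _ ((l1norm x + 1) * e1)); last first.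
    by rewrite /e1 mulrC divfK ?gt_eqF.
  rewrite ler_wpM2r ?(ltW e10)// -[leLHS]addr0 lerD//.
  by apply: ler_sum => j _; exact: ler_norm.
apply: (@bounded_coef_OmegaG _ K) => // i.
have c'V : 0 <= c'^-1 by rewrite invr_ge0 ltW.
have [->|fi0] := eqVneq (f i) 0.
  by rewrite mul0r addr_ge0// mulr_ge0// expR_ge0.
have fi : 0 < f i by rewrite lt_def fi0 f0.
have [ri|/ltW ir] := leP rr (l1norm (natvec R i)).
  apply: (@le_trans _ _ c'^-1); last by rewrite lerDr mulr_ge0// expR_ge0.
  rewrite -[f i]lnK ?posrE// -[c'^-1]lnK ?posrE ?invr_gt0// lnV ?posrE//.
  rewrite -expRD ler_expR -subr_le0 opprK -(pmulr_lle0 _ la0).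
  apply: le_trans (wi i fi ri).
  by rewrite innerZr !mulrDl mulrAC mulVf ?mul1r ?gt_eqF// addrCA addrA lexx.
apply: (@le_trans _ _ (`|K0| * expR (`|rr| * l1norm (th1 - th0)))); last first.
  by rewrite lerDl.
have -> : inner (natvec R i) th1 = inner (natvec R i) th0 + inner (natvec R i) (th1 - th0).
  by rewrite -innerDr addrC subrK.
rewrite expRD mulrA.
apply: ler_pM; rewrite ?expR_ge0 ?mulr_ge0 ?expR_ge0//.
  by rewrite (le_trans (K0le i))// ler_norm.
by apply: le_expR_inner; rewrite (le_trans ir)// ler_norm.
Qed.

End duality.

(** * Passage to the closure and to its boundary *)

Section support.
Variables (R : realType) (d : nat) (f : 'rV[nat]_d -> R).
Hypothesis f0 : forall i, 0 <= f i.
Implicit Types (th x : 'rV[R]_d).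

Lemma psiG_le_inner_closure x th : closure (OmegaG f) th ->
  (psiG f x <= (- inner x th)%:E)%E.
Proof.
move=> cth; apply/lee_addgt0Pr => e e0.
have [|th' Oth' near] := closure_l1norm cth (e := e / (l1norm x + 1)).
  by rewrite divr_gt0// ltr_wpDl// l1norm_ge0.
apply: le_trans (psiG_le_inner f0 x Oth') _.
rewrite -EFinD lee_fin lerNl opprD opprK lerBlDr.
rewrite -[th](subrK th') innerDr addrC lerD2l.
apply: le_trans (ler_norm _) _; apply: le_trans (ler_norm_inner _ _) _.
rewrite -(l1normN (th - th')) opprB.
have X1 : 0 < l1norm x + 1 by rewrite ltr_wpDl// l1norm_ge0.
apply: le_trans (_ : (l1norm x + 1) * (e / (l1norm x + 1)) <= _); last first.
  by rewrite mulrC divfK ?gt_eqF.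
by apply: ler_pM; rewrite ?l1norm_ge0 ?lerDl// ltW.
Qed.

Lemma boundary_above x th : (forall j, 0 <= x ord0 j) -> OmegaG f <> setT ->
  closure (OmegaG f) th ->
  exists2 th', boundary (closure (OmegaG f)) th' & inner x th <= inner x th'.
Proof.
move=> x0 ONT cth.
have [u Ou] : exists u, ~ OmegaG f u.
  apply: contrapT => h; apply: ONT; apply/seteqP; split => // u _.
  by apply: contrapT => nu; apply: h; exists u.
pose S := [set t : R | closure (OmegaG f) (th + const_mx t)].
have S0 : S 0 by rewrite /S/= (_ : const_mx 0 = 0) ?addr0//; apply/rowP => j; rewrite !mxE.
(* For larger [t], a point of [OmegaG f] within 1 of [th + const_mx t] would dominate [u], and
   stability under decrease would put [u] in [OmegaG f]. *)
have Sub : ubound S (l1norm th + l1norm u + 1).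
  move=> t; rewrite /S/= => ct; rewrite leNgt; apply/negP => tlt; apply: Ou.
  have [v Ov near] := closure_l1norm ct ltr01.
  apply: OmegaG_down Ov => // j.
  have h1 := le_lt_trans (le_l1norm _ j) near.
  have h2 := le_l1norm th j; have h3 := le_l1norm u j.
  move: h1 h2 h3; rewrite !mxE ltr_norml !ler_norml.
  by move=> /andP[? ?] /andP[? ?] /andP[? ?]; lra.
have hS : has_sup S by split; [exists 0|exists (l1norm th + l1norm u + 1)].
have T0 : 0 <= sup S by apply: (ub_le_sup hS.2).
exists (th + const_mx (sup S)); last first.
  apply: le_inner => // j; rewrite !mxE lerDl//.
(* Bounding by [d.+1] allows division by it in dimension 0 as well. *)
have l1c (r : R) : l1norm (const_mx r : 'rV[R]_d) <= `|r| * d.+1%:R.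
  rewrite /l1norm; under eq_bigr do rewrite mxE.
  by rewrite sumr_const card_ord -[leLHS]mulr_natr ler_wpM2l// ler_nat.
have dp (e : R) : 0 < e -> 0 < e / (2 * d.+1%:R) by move=> e0; rewrite divr_gt0// mulr_gt0.
have dE (e : R) : e / (2 * d.+1%:R) * d.+1%:R = e / 2.
  by field.
split.
  apply: subset_closure; apply: l1norm_closure => e e0.
  have [t St supt] := sup_adherent (dp e e0) hS.
  have tsup : t <= sup S by apply: (ub_le_sup hS.2).
  have e20 : 0 < e / 2 by rewrite divr_gt0.
  have [q Oq qt] := closure_l1norm St e20; exists q => //.
  have -> : q - (th + const_mx (sup S)) = q - (th + const_mx t) + const_mx (t - sup S).
    by apply/rowP => j; rewrite !mxE; ring.
  apply: le_lt_trans (l1normD _ _) _.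
  have -> : e = e / 2 + e / 2 by field.
  apply: ltr_leD => //; apply: le_trans (l1c _) _; rewrite -dE ler_wpM2r//.
  by rewrite distrC ger0_norm ?subr_ge0// lerBlDr -lerBlDl ltW.
(* Were the point at height [sup S] interior, it could be raised further by [r] inside the
   closure. *)
move=> int; have [e e0 eint] := open_l1ball (@open_interior _ _) int.
have := dp e e0; set r := e / _ => r0.
have /interior_subset Sr : (closure (OmegaG f))° (th + const_mx (sup S + r)).
  apply: eint.
  have -> : th + const_mx (sup S + r) - (th + const_mx (sup S)) = const_mx r.
    by apply/rowP => j; rewrite !mxE; ring.
  apply: le_lt_trans (l1c r) _; rewrite gtr0_norm// dE.
  by rewrite ltr_pdivrMr// ltr_pMr// ltr1n.
have : sup S + r <= sup S by apply: (ub_le_sup hS.2).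
by rewrite gerDl leNgt r0.
Qed.

End support.
Theorem theorem2 (R : realType) (d : nat) (f : 'rV[nat]_d -> R) :
  (forall i, 0 <= f i) ->
  convD f !=set0 ->
  (exists a b c : R, [/\ 0 < a, 0 < b, 0 < c &
     forall x y : 'rV[R]_d,
       (c%:E * nuG f (l1ball x b) * nuG f (l1ball y b)
          <= nuG f (l1ball (x + y) a))%E]) ->
  (ereal_sup [set psiG f x | x in [set x : 'rV[R]_d | l1norm x = 1%R]] < +oo)%E ->
  [/\ (forall x : 'rV[R]_d,
         (- psiG f x)%E =
         ereal_sup [set (inner x th)%:E | th in closure (OmegaG f)]),
      (forall x : 'rV[R]_d, (forall j, 0 <= x ord0 j) ->
         psiG f x =
         ereal_inf [set (inner x th)%:E
                   | th in [set th | closure (OmegaG f) (- th)]])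
    & (OmegaG f <> setT ->
       forall x : 'rV[R]_d, (forall j, 0 <= x ord0 j) ->
         psiG f x =
         ereal_inf [set (inner x th)%:E
                   | th in [set th | boundary (closure (OmegaG f)) (- th)]])].
Proof.
move=> f0 D0 [a [b [c [a0 b0 c0 CG]]]] _.
have [c' c'0 fM] := coef_supermultiplicative f0 b0 c0 CG.
have [th0 Oth0] := OmegaG_nonempty f0 D0.
have supE x : (- psiG f x)%E =
    ereal_sup [set (inner x th)%:E | th in closure (OmegaG f)].
  apply/eqP; rewrite eq_le; apply/andP; split; last first.
    apply: ge_ereal_sup => _ [th cth <-].
    by rewrite leeNr -EFinN psiG_le_inner_closure.
  set S := ereal_sup _.
  have leS th : OmegaG f th -> ((inner x th)%:E <= S)%E.
    by move=> Oth; apply: ereal_sup_ubound; exists th => //; exact: subset_closure.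
  have [x0|x0] := eqVneq x 0.
    rewrite x0 in leS *; rewrite /psiG eqxx oppe0; apply: le_trans (leS _ Oth0).
    by rewrite lee_fin /inner big1// => j _; rewrite mxE mul0r.
  rewrite leNgt; apply/negP => Spsi.
  (* The supremum [S] is not [-oo] because [OmegaG f] is nonempty, and not [+oo] by [Spsi]. When
     [- psiG f x] is [+oo], any real above [S] serves. *)
  have [s Ss spsi] : exists2 s : R, (S < s%:E)%E & (s%:E < - psiG f x)%E.
    move: (leS _ Oth0) Spsi; case: S {leS} => [u _| |]; last by rewrite leeNy_eq.
      case: (- psiG f x)%E => [v|_|]; last by rewrite ltNge leNye.
        rewrite lte_fin => uv; exists ((u + v) / 2); rewrite lte_fin.
          by rewrite ltr_pdivlMr//; lra.
        by rewrite ltr_pdivrMr//; lra.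
      by exists (u + 1); rewrite ?ltry// lte_fin ltrDl.
    by move=> _; rewrite ltNge leey.
  have psis : (psiG f x < (- s)%:E)%E by rewrite EFinN lteNr.
  have [th Oth sth] := psiG_lt_witness f0 a0 c'0 fM (ex_intro _ _ Oth0) x0 psis.
  by have := lt_le_trans Ss (le_trans _ (leS _ Oth)); rewrite lee_fin ltxx => /(_ sth).
have infE x : psiG f x =
    ereal_inf [set (inner x th)%:E | th in [set th | closure (OmegaG f) (- th)]].
  rewrite -[LHS]oppeK supE /ereal_inf; congr (- ereal_sup _)%E.
  apply/seteqP; split => [_ [th cth <-]|_ [_ [th cth <-] <-]].
    exists (inner x (- th))%:E; last by rewrite innerNr EFinN oppeK.
    by exists (- th); rewrite //= opprK.
  by exists (- th); rewrite // innerNr EFinN.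
split=> // ONT x x0; rewrite infE; apply/eqP; rewrite eq_le; apply/andP; split.
  apply: le_ereal_inf => _ [th [cth _] <-]; exists th => //=.
  exact: (@closed_closure _ (OmegaG f) _ cth).
apply: le_ereal_inf_tmp => _ [th cth <-].
have [th' bth' le] := boundary_above f0 x0 ONT cth.
apply: (@le_trans _ _ (inner x (- th'))%:E).
  by apply: ereal_inf_lbound; exists (- th') => //=; rewrite opprK.
by rewrite lee_fin innerNr lerNl -innerNr.
Qed.
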